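(* Let $n\ge 3$ be an integer and let $G$ be a connected balanced bipartite graph on $2n$ vertices (i.e., both parts have $n$ vertices). If $\lambda_1(D(G))\le \lambda_1(D(B_{n-1,n-2}))$, then $G$ has a perfect matching unless $G\cong B_{n-1,n-2}$, where $B_{n-1,n-2}$ is the graph obtained from the complete bipartite graph $K_{n,n-2}$ by attaching two pendent vertices to one vertex of the part of size $n$.
   Context: All graphs are finite, simple, undirected and connected. For a connected graph $H$ with vertices $v_1,\dots,v_m$, the distance matrix $D(H)$ is the $m\times m$ matrix whose $(i,j)$-entry is the length of a shortest path between $v_i$ and $v_j$; its largest eigenvalue $\lambda_1(D(H))$ is the distance spectral radius. A perfect matching is a set of pairwise nonadjacent edges covering every vertex. A pendent vertex is a vertex of degree $1$; attaching a pendent vertex to $v$ means adding a new vertex adjacent only to $v$. *)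

(* Defs.v *)
From HB Require Import structures.
From mathcomp Require Import all_boot all_order all_algebra.
From mathcomp Require Import reals.
Set Implicit Arguments. Unset Strict Implicit. Unset Printing Implicit Defensive.
Import Order.TTheory GRing.Theory Num.Theory.

Definition simple_graph (T : finType) (e : rel T) : Prop :=
  symmetric e /\ irreflexive e.

Definition connected_graph (T : finType) (e : rel T) : Prop :=
  forall x y : T, connect e x y.

Definition balanced_bipartite (T : finType) (e : rel T) (n : nat) : Prop :=
  #|T| = n.*2 /\
  exists A : {set T}, [/\ #|A| = n, #|~: A| = n &
    forall x y, e x y -> (x \in A) != (y \in A)].

Fixpoint walk (T : finType) (e : rel T) (k : nat) (u v : T) : bool :=
  if k is k'.+1 then [exists w, e u w && walk e k' w v] else u == v.

(* distance: least k such that a walk (hence a path) of length k joins u, v.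
   Shortest paths have length < #|T|, so for connected graphs this is the
   usual graph distance (for unreachable pairs it would be #|T|). *)
Definition gdist (T : finType) (e : rel T) (u v : T) : nat :=
  find (fun k => walk e k u v) (iota 0 #|T|).

Definition distmx (R : realType) (T : finType) (e : rel T) : 'M[R]_#|T| :=
  \matrix_(i, j) ((gdist e (enum_val i) (enum_val j))%:R)%R.

Definition largest_eigenvalue (R : realType) (m : nat) (A : 'M[R]_m) (r : R)
  : Prop :=
  eigenvalue A r /\ forall a : R, eigenvalue A a -> (a <= r)%R.

Definition perfect_matching (T : finType) (e : rel T) (M : {set {set T}})
  : Prop :=
  [/\ forall E, E \in M -> exists x y, e x y /\ E = [set x; y],
      forall E1 E2, E1 \in M -> E2 \in M -> E1 != E2 -> [disjoint E1 & E2]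
    & forall x, exists2 E, E \in M & x \in E].

Definition has_perfect_matching (T : finType) (e : rel T) : Prop :=
  exists M, perfect_matching e M.

Definition isomorphic (T1 T2 : finType) (e1 : rel T1) (e2 : rel T2) : Prop :=
  exists f : T1 -> T2, bijective f /\ forall x y, e2 (f x) (f y) = e1 x y.

(* B_{n-1,n-2} on vertex set 'I_(2n):
   part X = {0,...,n-1} (size n), part Y = {n,...,2n-3} (size n-2),
   K_{n,n-2} between X and Y, plus pendent vertices 2n-2 and 2n-1
   attached to vertex 0 of X. *)
Definition B_edge (n : nat) (i j : nat) : bool :=
  ((i < n) && (n <= j < n.*2 - 2)) ||
  ((i == 0) && (n.*2 - 2 <= j < n.*2)).

Definition Bgraph (n : nat) : rel 'I_(n.*2) :=
  fun i j => B_edge n i j || B_edge n j i.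

(* Main.v *)
(* If [G] has no perfect matching, Hall's theorem yields sets [S] and [Q] in
   opposite parts, with no edge between them and [|S| + |Q| = n + 1]; by symmetry
   [2 <= |S| <= |Q|].  Hence distances in [G] are at least those of the graph
   [K_{n,n}] with the edges between [S] and [Q] removed, which is [B_{n-1,n-2}]
   when [|S| = 2].  The Perron vector of [B_{n-1,n-2}] takes four values
   [a, b, c, d]; transplanted to [G] it is a test vector for the Rayleigh
   quotient of [D(G)].  When [|S| = 2] it gives [r2 <= r1], strictly unless [G] is
   [B_{n-1,n-2}].  When [|S| >= 3] the quotient is larger than [r2] as soon as
   [2 a < |Q| b], which follows from [a < 2 b] if [|Q| >= 4].  The remaining case
   [n = 5], [|S| = |Q| = 3] is settled by explicit numerical bounds. *)

Require Import Defs.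
From HB Require Import structures.
From mathcomp Require Import all_boot all_order all_algebra.
From mathcomp Require Import reals.
From mathcomp Require Import spectral complex zify ring lra.
Import Order.TTheory GRing.Theory Num.Theory.
Local Open Scope ring_scope.

Set Implicit Arguments.
Unset Strict Implicit.
Unset Printing Implicit Defensive.

(** * Rayleigh quotients and Perron vectors *)

(** Over [R[i]] the matrix is Hermitian, hence unitarily diagonalizable. Its diagonal entries are
    real, and each is an eigenvalue of [A], so the form is bounded termwise in the rotated
    coordinates [y]. *)
Lemma rayleigh_le (R : rcfType) (m : nat) (A : 'M[R]_m) (r : R) :
  A^T = A -> (forall a, eigenvalue A a -> a <= r) ->
  forall x : 'rV[R]_m, (x *m A *m x^T) 0 0 <= r * (x *m x^T) 0 0.
Proof.
move=> symA ler x.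
pose C := (R[i] : numClosedFieldType)%C.
pose f : {rmorphism R -> C} := real_complex R.
pose B : 'M[C]_m := map_mx f A.
have realB : B \is a mxOver Num.real.
  by apply/mxOverP => i j; rewrite mxE complex_real.
have hermB : B \is hermsymmx.
  apply: realsym_hermsym => //; apply/is_hermitianmxP.
  by rewrite expr0 scale1r map_mx_id // /B map_trmx symA.
have /orthomx_spectralP := hermitian_normalmx hermB.
have /mxOverP realD := hermitian_spectral_diag_real hermB.
have := spectral_unitarymx B; have := spectral_unit B.
set P := spectralmx B; set d := spectral_diag B => unitP unitaryP defB.
have led i : d 0 i <= f r.
  have [k dk] : exists k : R, d 0 i = k%:C%C by apply/complex_realP; apply: realD.
  rewrite dk lecR; apply: ler.
  rewrite -(eigenvalue_map f) -/B -[f k]/(k%:C)%C -dk.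
  apply/eigenvalueP; exists (row i P).
    rewrite -row_mul defB !mulmxA mulmxV // mul1mx row_mul row_diag_mx.
    by rewrite -scalemxAl -rowE.
  (* A zero row would make the determinant of [P] vanish. *)
  apply: contraTneq unitP => rowP0; rewrite unitmxE.
  have -> : P = \matrix_(k < m) (if k == i then 0 else row k P).
    by apply/row_matrixP => j; rewrite rowK; case: eqP => [->|].
  by rewrite (expand_det_row _ i) big1 ?unitr0 // => j _; rewrite mxE eqxx mxE mul0r.
pose z : 'rV[C]_m := map_mx f x.
pose y := z *m (P^t*)%sesqui.
have zadj : (z^t*)%sesqui = z^T.
  by apply/matrixP => i j; rewrite !mxE; apply: conjc_real.
have yadj : (y^t*)%sesqui = P *m z^T.
  rewrite /y trmx_mul (map_mxM (@Num.conj C)) -map_trmx zadj; congr (_ *m _).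
  by apply/matrixP => i j; rewrite !mxE; apply: conjCK.
suff: (z *m B *m z^T) 0 0 <= f r * (z *m z^T) 0 0.
  rewrite /z /B map_trmx -!map_mxM [(map_mx _ (x *m A *m _)) _ _]mxE.
  by rewrite [(map_mx _ (x *m _)) _ _]mxE -rmorphM /= lecR.
have -> : z *m B *m z^T = y *m diag_mx d *m (y^t*)%sesqui.
  by rewrite yadj defB invmx_unitary // !mulmxA.
have -> : z *m z^T = y *m (y^t*)%sesqui.
  by rewrite yadj /y !mulmxA -invmx_unitary // mulmxKV.
rewrite !mxE mulr_sumr; apply: ler_sum => i _.
rewrite mul_mx_diag !mxE mulrAC mulrC.
by apply: ler_wpM2r; rewrite ?led // mul_conjC_ge0.
Qed.

(** Allows sums over vertices instead of ordinals; [distmx] is convertible to the case where [K] is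
    [gdist] cast into [R]. *)
Definition kernelmx (R : Type) (T : finType) (K : T -> T -> R) : 'M[R]_#|T| :=
  \matrix_(i, j) K (enum_val i) (enum_val j).

Lemma kernelmxE (R : Type) (T : finType) (K : T -> T -> R) i j :
  kernelmx K i j = K (enum_val i) (enum_val j).
Proof. by rewrite mxE. Qed.

Lemma sum_enum_val (R : nmodType) (T : finType) (F : T -> R) :
  \sum_(i < #|T|) F (enum_val i) = \sum_u F u.
Proof.
rewrite [RHS](reindex (@enum_val T T)) //.
exact: (onW_bij _ (@enum_val_bij T)).
Qed.

Lemma kernel_form_le (R : realType) (T : finType) (K : T -> T -> R) (r : R) :
  (forall u v, K u v = K v u) -> largest_eigenvalue (kernelmx K) r ->
  forall h : T -> R, \sum_u h u * (\sum_v K u v * h v) <= r * \sum_u h u ^+ 2.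
Proof.
move=> symK [_ ler] h.
pose x : 'rV[R]_#|T| := \row_i h (enum_val i).
have symA : (kernelmx K)^T = kernelmx K.
  by apply/matrixP => i j; rewrite !(mxE, kernelmxE).
have <- : (x *m kernelmx K *m x^T) 0 0 = \sum_u h u * (\sum_v K u v * h v).
  rewrite mxE -[RHS]sum_enum_val; apply: eq_bigr => i _.
  rewrite [x^T _ _]mxE [x _ _]mxE mulrC mxE -[X in _ = _ * X]sum_enum_val; congr (_ * _).
  by apply: eq_bigr => j _; rewrite kernelmxE mxE mulrC symK.
have <- : (x *m x^T) 0 0 = \sum_u h u ^+ 2; last exact: rayleigh_le.
by rewrite mxE -[RHS]sum_enum_val; apply: eq_bigr => i _; rewrite !mxE expr2.
Qed.

(* The entrywise absolute value [w] of a top eigenvector still maximizes the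
   Rayleigh quotient, so moving it along its residual [g] cannot increase it. *)
Lemma perron_vector (R : realType) (T : finType) (K : T -> T -> R) (r : R) :
  (forall u v, K u v = K v u) -> (forall u v, 0 <= K u v) ->
  (forall u v, u != v -> 0 < K u v) -> largest_eigenvalue (kernelmx K) r ->
  exists h : T -> R, (forall u, 0 < h u) /\
    forall u, \sum_v K u v * h v = r * h u.
Proof.
move=> symK K_ge0 K_gt0 maxr; have le_r := kernel_form_le symK maxr.
have [/eigenvalueP[x xK x_neq0] _] := maxr.
pose h u := x 0 (enum_rank u).
have hK u : \sum_v K u v * h v = r * h u.
  have /rowP/(_ (enum_rank u)) := xK; rewrite !(mxE, kernelmxE) => <-.
  rewrite -[LHS]sum_enum_val; apply: eq_bigr => i _.
  by rewrite !(mxE, kernelmxE) enum_rankK mulrC symK /h enum_valK.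
have [u0 hu0] : exists u, h u != 0.
  have [i xi] : exists i, x 0 i != 0.
    apply/existsP; apply: contraNT x_neq0 => /existsPn x0.
    by apply/eqP/rowP => i; rewrite mxE; apply/eqP; rewrite -[_ == _]negbK x0.
  by exists (enum_val i); rewrite /h enum_valK.
(* [L] is the operator [r - K], symmetric and positive semidefinite. The aim is [L w = 0]. *)
pose w u := `|h u|.
pose L (k : T -> R) u := r * k u - \sum_v K u v * k v.
have symL k k' : \sum_u k u * L k' u = \sum_u k' u * L k u.
  rewrite /L; under eq_bigr => u _ do rewrite mulrBr mulrCA.
  under [RHS]eq_bigr => u _ do rewrite mulrBr mulrCA.
  rewrite !sumrB; congr (_ - _).
    by apply: eq_bigr => u _; rewrite [k u * _]mulrC.
  under eq_bigr => u _ do rewrite mulr_sumr.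
  under [RHS]eq_bigr => u _ do rewrite mulr_sumr.
  rewrite exchange_big; apply: eq_bigr => u _; apply: eq_bigr => v _.
  by rewrite symK; ring.
have psdL k : 0 <= \sum_u k u * L k u.
  rewrite /L; under eq_bigr => u _ do rewrite mulrBr mulrCA -expr2.
  by rewrite sumrB -mulr_sumr subr_ge0.
(* The bound from above is the triangle inequality applied to [r * h u], as [K] is nonnegative. *)
have wL0 : \sum_u w u * L w u = 0.
  apply/eqP; rewrite eq_le psdL andbT.
  rewrite /L; under eq_bigr => u _ do rewrite mulrBr.
  rewrite sumrB subr_le0; apply: ler_sum => u _.
  rewrite mulrCA -expr2 real_normK ?num_real // expr2 mulrCA -hK.
  apply: le_trans (ler_norm _) _; rewrite normrM ler_wpM2l //.
  apply: le_trans (ler_norm_sum _ _ _) _; apply: ler_sum => v _.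
  by rewrite normrM ger0_norm.
have addL k k' t u : L (fun v => k v + t * k' v) u = L k u + t * L k' u.
  rewrite /L mulrDr; under eq_bigr => v _ do rewrite mulrDr mulrCA.
  by rewrite big_split -mulr_sumr /=; ring.
pose g := L w.
have g0 : \sum_u g u ^+ 2 = 0.
  apply/eqP; rewrite -[_ == _]negbK; apply/negP => N_neq0.
  have N_gt0 : 0 < \sum_u g u ^+ 2.
    by rewrite lt0r N_neq0 sumr_ge0 // => u _; rewrite sqr_ge0.
  move: N_gt0 (psdL g); set N := \sum_u _; set q := \sum_u _ => N_gt0 q_ge0.
  (* The form at [w + t g] is [2 t N + t ^ 2 q], which is negative for this [t]. The [+ 1] keeps the
     denominator positive when [q = 0]. *)
  pose t := - N / (q + 1).
  have := psdL (fun u => w u + t * g u).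
  have -> : \sum_u (w u + t * g u) * L (fun v => w v + t * g v) u =
      \sum_u w u * L w u + t * (\sum_u w u * L g u) +
      t * (\sum_u g u * L w u) + t ^+ 2 * \sum_u g u * L g u.
    rewrite !mulr_sumr -!big_split; apply: eq_bigr => u _ /=.
    by rewrite addL; ring.
  have gL : \sum_u g u * L w u = N by apply: eq_bigr => u _; rewrite -expr2.
  rewrite wL0 [\sum_u w u * L g u]symL gL -/q.
  have -> : 0 + t * N + t * N + t ^+ 2 * q = - (N ^+ 2 * (q + 2)) / (q + 1) ^+ 2.
    by rewrite /t; field; rewrite gt_eqF // ltr_wpDl.
  by rewrite leNgt mulNr oppr_lt0 divr_gt0 ?mulr_gt0 ?exprn_gt0 ?ltr_wpDl.
have wK u : \sum_v K u v * w v = r * w u.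
  have /eqP := g0; rewrite psumr_eq0 => [/allP/(_ u)|v _]; last exact: sqr_ge0.
  by rewrite mem_index_enum sqrf_eq0 subr_eq0 => /(_ isT)/eqP.
exists w; split => // u.
(* If [w u = 0], every term [K u v * w v] vanishes, contrary to [K u u0 > 0] and [w u0 > 0]. *)
rewrite lt0r normr_ge0 andbT; apply/negP => /eqP wu0.
have := wK u; rewrite wu0 mulr0 => /eqP.
have u_neq : u != u0 by apply: contraNneq hu0 => <-; rewrite -normr_eq0 -/(w u) wu0.
rewrite psumr_eq0 => [/allP/(_ u0)|v _]; last by rewrite mulr_ge0 ?normr_ge0.
rewrite mem_index_enum => /(_ isT)/=; rewrite mulf_eq0 normr_eq0 (negPf hu0) orbF.
by rewrite gt_eqF ?K_gt0.
Qed.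

(** * Hall's theorem *)

Local Open Scope nat_scope.

(* Halmos-Vaughan: if some proper nonempty [S] is tight, match [S] and [A :\: S]
   separately; otherwise any single edge can be removed. *)
Lemma hall (T U : finType) (u0 : U) (r : T -> {set U}) (A : {set T}) :
  (forall S : {set T}, S \subset A -> #|S| <= #|\bigcup_(x in S) r x|) ->
  exists f : T -> U, {in A &, injective f} /\ {in A, forall x, f x \in r x}.
Proof.
move: {2}#|A|.+1 (ltnSn #|A|) => k; elim: k A r => // k IHk A r ltAk hallA.
have [/existsP[S /and3P[SA S0 /eqP tightS]]|] :=
  boolP [exists S : {set T}, [&& S \proper A, S != set0 &
                                 #|\bigcup_(x in S) r x| == #|S|]].
  set N := \bigcup_(x in S) r x in tightS.
  have subSA := proper_sub SA.
  have [||f1 [inj1 f1r]] := IHk S r.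
  - exact: leq_trans (proper_card SA) _.
  - by move=> W WS; apply: hallA; apply: subset_trans subSA.
  have [||f2 [inj2 f2r]] := IHk (A :\: S) (fun x => r x :\: N).
  - rewrite cardsD (setIidPr subSA); have : 0 < #|S| by rewrite card_gt0.
    by have := subset_leq_card subSA; lia.
  - move=> W WAS; have WA := subset_trans WAS (subsetDl _ _).
    have dSW : [disjoint S & W].
      rewrite disjoint_sym disjoint_subset; apply/subsetP => x /(subsetP WAS).
      by rewrite !inE => /andP[].
    (* As [S] is tight, Hall's condition for the disjoint union of [S] and [W] leaves at least
       [#|W|] neighbours of [W] outside [N]. *)
    have := hallA (S :|: W); rewrite subUset subSA WA => /(_ isT).
    rewrite cardsU (disjoint_setI0 dSW) cards0 subn0 -tightS => le_SW.
    rewrite -(leq_add2l #|N|); apply: leq_trans le_SW _.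
    apply: leq_trans (leq_card_setU _ _); apply: subset_leq_card.
    apply/subsetP => y /bigcupP[x xSW yx]; rewrite inE.
    have [//|yN /=] := boolP (y \in N); apply/bigcupP.
    case/setUP: xSW => [xS|xW]; last by exists x; rewrite // inE yN.
    by case/negP: yN; apply/bigcupP; exists x.
  exists (fun x => if x \in S then f1 x else f2 x).
  have f2N x : x \in A -> x \notin S -> f2 x \in r x :\: N.
    by move=> xA xS; apply: f2r; rewrite inE xS.
  have f1N x : x \in S -> f1 x \in N.
    by move=> xS; apply/bigcupP; exists x; rewrite ?f1r.
  split=> [x y xA yA|x xA]; last first.
    by case: ifPn => xS; [rewrite f1r | have := f2N _ xA xS; rewrite inE => /andP[]].
  case: ifPn => xS; case: ifPn => yS fxy; first exact: inj1.
  - by have := f2N _ yA yS; rewrite -fxy inE f1N.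
  - by have := f2N _ xA xS; rewrite fxy inE f1N.
  - by apply: inj2; rewrite // inE ?xS ?yS.
move=> /existsPn notight.
have [->|[x xA]] := set_0Vmem A; first by exists (fun=> u0); split=> x; rewrite !inE.
have [y yx] : exists y, y \in r x.
  have := hallA [set x]; rewrite sub1set xA big_set1 cards1 => /(_ isT).
  by case/card_gt0P => y; exists y.
have [||f [injf fr]] := IHk (A :\ x) (fun z => r z :\ y).
- by move: ltAk; rewrite (cardsD1 x A) xA.
- move=> W WAx; have [->|W0] := eqVneq W set0; first by rewrite cards0.
  have Wprop : W \proper A.
    rewrite properE (subset_trans WAx (subD1set _ _)) /=; apply/subsetPn.
    by exists x => //; apply/negP => /(subsetP WAx); rewrite !inE eqxx.
  (* [W] is not tight, so its neighbourhood has an element to spare and may lose [y]. *)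
  have := notight W; rewrite Wprop W0 /= => neqW.
  have := hallA W (proper_sub Wprop); rewrite leq_eqVlt eq_sym (negPf neqW) /= => ltW.
  rewrite -ltnS; apply: leq_trans ltW _.
  rewrite (cardsD1 y); apply: (@leq_add _ _ 1); first by case: (y \in _).
  apply: subset_leq_card; apply/subsetP => z; rewrite !inE => /andP[zy /bigcupP[v vW zv]].
  by apply/bigcupP; exists v; rewrite // !inE zy.
have fy z : z \in A -> z != x -> f z != y.
  by move=> zA zx; have := fr z; rewrite !inE zx zA => /(_ isT)/andP[].
exists (fun z => if z == x then y else f z); split=> [a b aA bA|a aA]; last first.
  have [->//|ax] := eqVneq a x.
  by have := fr a; rewrite !inE ax aA => /(_ isT)/andP[].
have [->|ax] := eqVneq a x; have [->|bx] := eqVneq b x => // fab.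
- by case/eqP: (fy _ bA bx).
- by case/eqP: (fy _ aA ax).
- by apply: injf; rewrite // !inE ?ax ?bx.
Qed.

(** Equal cardinalities force [f] to map [A] onto the other side, so the edges [{x, f x}] cover
    every vertex. *)
Lemma matching_of_injection (T : finType) (e : rel T) (A : {set T}) (f : T -> T) :
  #|A| = #|~: A| -> {in A &, injective f} ->
  {in A, forall x, f x \notin A /\ e x (f x)} -> has_perfect_matching e.
Proof.
move=> cardA injf fA.
have imf : f @: A = ~: A.
  apply/eqP; rewrite eqEcard card_in_imset // cardA leqnn andbT.
  by apply/subsetP => _ /imsetP[x xA ->]; rewrite inE; case: (fA x xA).
exists [set [set x; f x] | x in A]; split.
- by move=> _ /imsetP[x xA ->]; exists x, (f x); case: (fA x xA).
- move=> _ _ /imsetP[x xA ->] /imsetP[y yA ->].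
  have [->|xy _] := eqVneq x y; first by rewrite eqxx.
  have [fxA _] := fA _ xA; have [fyA _] := fA _ yA.
  rewrite -setI_eq0; apply/eqP/setP => z; rewrite !inE.
  apply/negP => /andP[/orP[]/eqP-> /orP[]/eqP].
  + by move/eqP: xy.
  + by move=> xfy; rewrite -xfy xA in fyA.
  + by move=> fxy; rewrite fxy yA in fxA.
  + by move/(injf _ _ xA yA); move/eqP: xy.
- move=> x; have [xA|xA] := boolP (x \in A).
    by exists [set x; f x]; rewrite ?inE ?eqxx //; apply: imset_f.
  have : x \in f @: A by rewrite imf inE.
  by case/imsetP => y yA ->; exists [set y; f y]; rewrite ?inE ?eqxx ?orbT //; apply: imset_f.
Qed.

Lemma connected_has_neighbour (T : finType) (e : rel T) (x : T) :
  connected_graph e -> 1 < #|T| -> exists y, e x y.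
Proof.
move=> conn /card_gt1P[a [b [_ _ ab]]].
have [y xy] : exists y, y != x.
  by have [<-|] := eqVneq a x; [exists b; rewrite eq_sym | exists a].
have /connectP[[|z p] /=] := conn x y; first by move=> _ yx; rewrite yx eqxx in xy.
by case/andP => xz _ _; exists z.
Qed.

Lemma subset_of_card (T : finType) (B : {set T}) k :
  k <= #|B| -> exists2 C : {set T}, C \subset B & #|C| = k.
Proof.
move=> le_k; exists [set x in take k (enum B)].
  by apply/subsetP => x; rewrite inE => /mem_take; rewrite mem_enum.
rewrite cardsE (card_uniqP _) ?take_uniq ?enum_uniq //.
by rewrite size_takel // -cardE.
Qed.

(* The set [Q] is taken inside the non-neighbours of a set [S] violating Hall's
   condition; exchanging the two parts makes [S] the smaller of the two. *)
Lemma perfect_matching_or_gap (T : finType) (e : rel T) (n : nat) :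
  3 <= n -> simple_graph e -> connected_graph e -> balanced_bipartite e n ->
  has_perfect_matching e \/
  exists A S Q : {set T},
    [/\ #|A| = n, #|~: A| = n & forall x y, e x y -> (x \in A) != (y \in A)] /\
    [/\ S \subset A, Q \subset ~: A & forall x y, x \in S -> y \in Q -> ~~ e x y] /\
    [/\ #|S| + #|Q| = n.+1, 2 <= #|S| & #|S| <= #|Q|].
Proof.
move=> n3 [sym_e _] conn [cardT [A [cA cAc bip]]].
have nbr x : exists y, e x y.
  by apply: connected_has_neighbour; rewrite // cardT; lia.
have [a aA] : exists a, a \in A by apply/card_gt0P; rewrite cA (leq_trans _ n3).
pose r x := [set y | e x y].
have [/forallP hallA|] := boolP [forall S : {set T}, (S \subset A) ==>
                                  (#|S| <= #|\bigcup_(x in S) r x|)].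
  left; have [|f [injf fr]] := @hall T T a r A; first by move=> S; apply/implyP.
  apply: (matching_of_injection (A := A) (f := f)); rewrite ?cA ?cAc // => x xA.
  have := fr x xA; rewrite inE => xf; split=> //.
  by have := bip _ _ xf; rewrite xA; case: (_ \in A).
case/forallPn => S; rewrite negb_imply -ltnNge => /andP[SA ltNS]; right.
set N := \bigcup_(x in S) r x in ltNS.
have NA : N \subset ~: A.
  apply/subsetP => y /bigcupP[x /(subsetP SA) xA]; rewrite !inE => /bip.
  by rewrite xA; case: (_ \in A).
have [x xS] : exists x, x \in S by apply/card_gt0P; case: #|S| ltNS.
(* Here [N] nonempty gives [2 <= #|S|]. Below, [#|S| < n] gives [2 <= #|Q|], needed when the two
   sides are exchanged. *)
have N_gt0 : 0 < #|N|.
  by have [y xy] := nbr x; apply/card_gt0P; exists y; apply/bigcupP; exists x; rewrite ?inE.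
have S_lt : #|S| < n.
  rewrite -cA ltn_neqAle subset_leq_card // andbT; apply: contraTneq ltNS => eqSA.
  rewrite -leqNgt eqSA cA -cAc; apply: subset_leq_card; apply/subsetP => y yA.
  have [z yz] := nbr y; apply/bigcupP; exists z; last by rewrite inE sym_e.
  have /eqP -> : S == A by rewrite eqEcard SA eqSA leqnn.
  by have := bip _ _ yz; move: yA; rewrite inE => /negPf->; case: (z \in A).
have [Q QN cQ] : exists2 Q : {set T}, Q \subset ~: A :\: N & #|Q| = n.+1 - #|S|.
  by apply: subset_of_card; rewrite cardsD (setIidPr NA) cAc; lia.
have noSQ u v : u \in S -> v \in Q -> ~~ e u v.
  move=> uS /(subsetP QN); rewrite inE => /andP[vN _]; apply: contraNN vN => uv.
  by apply/bigcupP; exists u; rewrite ?inE.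
have QA : Q \subset ~: A := subset_trans QN (subsetDl _ _).
have [leSQ|ltQS] := leqP #|S| #|Q|.
  by exists A, S, Q; split=> //; split=> //; split=> //; lia.
exists (~: A), Q, S; split; first split; rewrite ?setCK //.
  by move=> u v /bip; rewrite !inE; do 2 case: (_ \in A).
split; first by split=> // u v uQ vS; rewrite sym_e noSQ.
by split; lia.
Qed.

(** * Walks and distances *)

Lemma walkD (T : finType) (e : rel T) k l u v :
  walk e (k + l) u v = [exists w, walk e k u w && walk e l w v].
Proof.
elim: k u => [|k IHk] u /=.
  apply/idP/existsP => [uv|[w /andP[/eqP-> //]]].
  by exists u; rewrite eqxx.
apply/existsP/existsP => [[w /andP[uw]]|[w /andP[/existsP[z /andP[uz zw]] wv]]].
  rewrite IHk => /existsP[z /andP[wz zv]]; exists z; rewrite zv andbT.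
  by apply/existsP; exists w; rewrite uw.
by exists z; rewrite uz IHk; apply/existsP; exists w; rewrite zw.
Qed.

Lemma walk1 (T : finType) (e : rel T) u v : walk e 1 u v = e u v.
Proof.
apply/existsP/idP => [[w /andP[uw /eqP<-]] //|uv].
by exists v; rewrite uv eqxx.
Qed.

Lemma walk_sym (T : finType) (e : rel T) k u v :
  symmetric e -> walk e k u v = walk e k v u.
Proof.
move=> sym_e; elim: k u v => [|k IHk] u v; first exact: eq_sym.
rewrite -[in RHS]addn1 walkD; apply: eq_existsb => w.
by rewrite walk1 sym_e andbC IHk.
Qed.

Lemma gdist_sym (T : finType) (e : rel T) u v :
  symmetric e -> gdist e u v = gdist e v u.
Proof. by move=> sym_e; apply: eq_find => k; apply: walk_sym. Qed.

(** The search in [gdist] covers lengths below [#|T|] and returns [#|T|] on failure, hence the bound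
    on [k]. *)
Lemma gdist_ge (T : finType) (e : rel T) k u v :
  k <= #|T| -> (forall j, j < k -> ~~ walk e j u v) -> k <= gdist e u v.
Proof.
move=> le_kT nowalk; rewrite leqNgt; apply/negP => lt_k.
have ltT := leq_trans lt_k le_kT.
have : has (fun j => walk e j u v) (iota 0 #|T|) by rewrite has_find size_iota.
by move/(nth_find 0); rewrite nth_iota // add0n; apply/negP/nowalk.
Qed.

Lemma gdist_le (T : finType) (e : rel T) k u v :
  k < #|T| -> walk e k u v -> gdist e u v <= k.
Proof.
move=> lt_kT wk; rewrite leqNgt; apply/negP => /(before_find 0).
by rewrite nth_iota // add0n wk.
Qed.

Lemma walk_bipartite (T : finType) (e : rel T) (A : {set T}) k u v :
  (forall x y, e x y -> (x \in A) != (y \in A)) -> walk e k u v ->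
  odd k = (u \in A) (+) (v \in A).
Proof.
move=> bip; elim: k u => [|k IHk] u /=; first by move/eqP->; rewrite addbb.
case/existsP => w /andP[/bip uw /IHk->].
by move: uw; do 3 case: (_ \in A).
Qed.

(* The distance in the complete bipartite graph between [A] and [~: A] from which
   the edges between [S] and [Q] have been removed. *)
Definition gap_dist (T : finType) (A S Q : {set T}) (x y : T) : nat :=
  if x == y then 0 else if (x \in A) == (y \in A) then 2
  else if (x \in S) && (y \in Q) || (y \in S) && (x \in Q) then 3 else 1.

(** Each edge changes side, so parity excludes length 1 within a side and length 2 across. Between
    [S] and [Q] length 1 is excluded as well. *)
Lemma gap_dist_le_gdist (T : finType) (e : rel T) (A S Q : {set T}) x y :
  2 < #|T| -> symmetric e -> (forall x y, e x y -> (x \in A) != (y \in A)) ->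
  (forall x y, x \in S -> y \in Q -> ~~ e x y) ->
  gap_dist A S Q x y <= gdist e x y.
Proof.
move=> T3 sym_e bip noSQ; rewrite /gap_dist.
have [//|xy] := eqVneq x y.
have wodd k : walk e k x y -> odd k = (x \in A) (+) (y \in A) by apply: walk_bipartite.
have [sameA|diffA] := eqVneq (x \in A) (y \in A).
  apply: gdist_ge => [|[|[|//]] _ //]; first exact: ltnW.
  by apply/negP => /wodd; rewrite sameA addbb.
have diffb : (x \in A) (+) (y \in A) by move: diffA; do 2 case: (_ \in A).
case: ifP => [SQ|_]; last by apply: gdist_ge => [|[|//]]; rewrite ?(ltn_trans _ T3).
apply: gdist_ge => // -[|[|[|//]]] _ //; last by apply/negP => /wodd; rewrite diffb.
by rewrite walk1; case/orP: SQ => /andP[]; [|rewrite sym_e]; apply: noSQ.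
Qed.

(** A single missing edge is itself a gap between two singletons. *)
Lemma nonadjacent_gdist_ge3 (T : finType) (e : rel T) (A : {set T}) x y :
  2 < #|T| -> symmetric e -> (forall x y, e x y -> (x \in A) != (y \in A)) ->
  (x \in A) != (y \in A) -> ~~ e x y -> 3 <= gdist e x y.
Proof.
move=> T3 sym_e bip diffA nxy.
have xy : x != y by apply: contraNneq diffA => ->.
have := @gap_dist_le_gdist T e A [set x] [set y] x y T3 sym_e bip.
rewrite /gap_dist (negPf xy) (negPf diffA) !inE !eqxx; apply.
by move=> u v; rewrite !inE => /eqP-> /eqP->.
Qed.

(** * Quadratic forms of gap distances *)

Lemma gap_dist_sym (T : finType) (A S Q : {set T}) x y :
  gap_dist A S Q x y = gap_dist A S Q y x.
Proof. by rewrite /gap_dist (eq_sym x) (eq_sym (x \in A)) orbC. Qed.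

Local Open Scope ring_scope.

Section GapForm.
Variables (R : realFieldType) (T : finType) (A S Q : {set T}).
Hypotheses (SA : S \subset A) (QA : Q \subset ~: A).

Lemma sum_indicator (B : {set T}) (h : T -> R) :
  \sum_(y in B) h y = \sum_y (y \in B)%:R * h y.
Proof. by rewrite big_mkcond; apply: eq_bigr => y _; case: (_ \in _); rewrite (mul1r, mul0r). Qed.

(** Adding [2 I] replaces the zero diagonal by 2. The matrix then has constant blocks: 2 within a
    side, 1 across, and 2 more between [S] and [Q]. This is why [r + 2] appears from here on. *)
Lemma gap_dist_row (h : T -> R) (x : T) :
  \sum_y (gap_dist A S Q x y)%:R * h y + 2 * h x =
  if x \in A then 2 * (\sum_(y in A) h y) + \sum_(y in ~: A) h y +
                  2 * ((x \in S)%:R * \sum_(y in Q) h y)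
  else 2 * (\sum_(y in ~: A) h y) + \sum_(y in A) h y +
       2 * ((x \in Q)%:R * \sum_(y in S) h y).
Proof.
have -> : 2 * h x = \sum_y (2 * (x == y)%:R) * h y.
  rewrite (bigD1 x) //= eqxx mulr1 big1 ?addr0 // => y yx.
  by rewrite eq_sym (negPf yx) mulr0 mul0r.
rewrite -big_split /= !sum_indicator.
case: ifPn => xA; rewrite !mulr_sumr -!big_split /=; apply: eq_bigr => y _;
  rewrite !inE /gap_dist.
- have xQ : x \in Q = false.
    by apply/negP => /(subsetP QA); rewrite inE xA.
  rewrite xA xQ andbF orbF; have [<-|xy] := eqVneq x y.
    by rewrite xA xQ /=; ring.
  have [yA|yA] := boolP (y \in A); last by case: (x \in S); case: (y \in Q) => /=; ring.
  have -> : y \in Q = false by apply/negP => /(subsetP QA); rewrite inE yA.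
  by rewrite /=; ring.
- have xS : x \in S = false by apply/negP => /(subsetP SA); rewrite (negPf xA).
  rewrite (negPf xA) xS /=; have [<-|xy] := eqVneq x y.
    by rewrite (negPf xA) xS /=; ring.
  have [yA|yA] := boolP (y \in A); first by case: (x \in Q); case: (y \in S) => /=; ring.
  have -> : y \in S = false by apply/negP => /(subsetP SA); rewrite (negPf yA).
  by rewrite /=; ring.
Qed.

Lemma gap_dist_form (h : T -> R) :
  \sum_x h x * (\sum_y (gap_dist A S Q x y)%:R * h y) + 2 * \sum_x h x ^+ 2 =
  2 * (\sum_(y in A) h y) ^+ 2 + 2 * (\sum_(y in ~: A) h y) ^+ 2 +
  2 * (\sum_(y in A) h y) * (\sum_(y in ~: A) h y) +
  4 * (\sum_(y in S) h y) * (\sum_(y in Q) h y).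
Proof.
have -> : \sum_x h x * (\sum_y (gap_dist A S Q x y)%:R * h y) + 2 * \sum_x h x ^+ 2 =
    \sum_x h x * (\sum_y (gap_dist A S Q x y)%:R * h y + 2 * h x).
  by rewrite mulr_sumr -big_split; apply: eq_bigr => x _ /=; ring.
under eq_bigr => x _ do rewrite gap_dist_row.
set a := \sum_(y in A) h y; set b := \sum_(y in ~: A) h y.
set s := \sum_(y in S) h y; set t := \sum_(y in Q) h y.
transitivity (\sum_(x in A) h x * (2 * a + b) + \sum_(x in ~: A) h x * (2 * b + a) +
              \sum_(x in S) h x * (2 * t) + \sum_(x in Q) h x * (2 * s)).
  rewrite !(sum_indicator _ (fun x => h x * _)) -!big_split; apply: eq_bigr => x _ /=.
  rewrite inE; case: ifPn => xA.
    have -> : x \in Q = false by apply/negP => /(subsetP QA); rewrite inE xA.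
    by rewrite /=; ring.
  have -> : x \in S = false by apply/negP => /(subsetP SA); rewrite (negPf xA).
  by rewrite /=; ring.
by rewrite -!mulr_suml -/a -/b -/s -/t; ring.
Qed.

End GapForm.

(* The Perron vector is constant on [S], [A :\: S], [~: A :\: Q] and [Q]. *)
Lemma gap_perron (R : realType) (T : finType) (A S Q : {set T}) (r : R) :
  S \subset A -> Q \subset ~: A -> A != set0 ->
  largest_eigenvalue (kernelmx (fun u v => (gap_dist A S Q u v)%:R)) r ->
  exists a b c d : R, let p := a * #|S|%:R + b * #|A :\: S|%:R in
    let q := d * #|Q|%:R + c * #|~: A :\: Q|%:R in
    [/\ 0 < a, 0 < b, 0 < c & 0 < d] /\
    [/\ (r + 2) * a = 2 * p + q + 2 * (d * #|Q|%:R), (r + 2) * b = 2 * p + q,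
        (r + 2) * c = 2 * q + p & (r + 2) * d = 2 * q + p + 2 * (a * #|S|%:R)].
Proof.
move=> SA QA /set0Pn[x0 x0A] maxr.
have [u v|u v|u v uv|//|h [h_gt0 hK]] :=
  @perron_vector R T (fun u v => (gap_dist A S Q u v)%:R) r.
- by rewrite gap_dist_sym.
- exact: ler0n.
- by rewrite ltr0n /gap_dist (negPf uv); case: ifP => // _; case: ifP.
have hE x := gap_dist_row SA QA h x.
set p := \sum_(y in A) h y in hE; set q := \sum_(y in ~: A) h y in hE.
set s := \sum_(y in S) h y in hE; set t := \sum_(y in Q) h y in hE.
have sum_ge0 (B : {set T}) : 0 <= \sum_(y in B) h y.
  by apply: sumr_ge0 => y _; apply: ltW.
have p_gt0 : 0 < p.
  by rewrite /p (bigD1 x0) //= ltr_wpDr // sumr_ge0 // => y _; apply: ltW.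
have q_ge0 : 0 <= q := sum_ge0 _.
have s_ge0 : 0 <= s := sum_ge0 _.
have t_ge0 : 0 <= t := sum_ge0 _.
have r_gt0 : 0 < r + 2.
  have := hE x0; rewrite x0A hK -mulrDl => E.
  rewrite -(pmulr_lgt0 _ (h_gt0 x0)) E ltr_wpDr ?mulr_ge0 ?ler0n //; lra.
(* Dividing by [r + 2] expresses [h x] through the class of [x] alone. *)
have val x : h x = (if x \in A then 2 * p + q + 2 * ((x \in S)%:R * t)
                    else 2 * q + p + 2 * ((x \in Q)%:R * s)) / (r + 2).
  by rewrite -hE hK -mulrDl mulrAC mulfV ?mul1r // gt_eqF.
pose a := (2 * p + q + 2 * t) / (r + 2); pose b := (2 * p + q) / (r + 2).
pose c := (2 * q + p) / (r + 2); pose d := (2 * q + p + 2 * s) / (r + 2).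
have sumS : s = a * #|S|%:R.
  rewrite mulr_natr -sumr_const; apply: eq_bigr => x xS.
  by rewrite val (subsetP SA) // xS mul1r.
have sumQ : t = d * #|Q|%:R.
  rewrite mulr_natr -sumr_const; apply: eq_bigr => x xQ.
  by have := subsetP QA _ xQ; rewrite inE val xQ mul1r => /negPf->.
have sumA : p = a * #|S|%:R + b * #|A :\: S|%:R.
  rewrite {1}/p (big_setID S) /= (setIidPr SA) -/s sumS; congr (_ + _).
  rewrite mulr_natr -sumr_const; apply: eq_bigr => x; rewrite inE => /andP[/negPf xS xA].
  by rewrite val xA xS mul0r mulr0 addr0.
have sumAc : q = d * #|Q|%:R + c * #|~: A :\: Q|%:R.
  rewrite {1}/q (big_setID Q) /= (setIidPr QA) -/t sumQ; congr (_ + _).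
  rewrite mulr_natr -sumr_const; apply: eq_bigr => x; rewrite !inE => /andP[/negPf xQ /negPf xA].
  by rewrite val xA xQ mul0r mulr0 addr0.
have r_neq0 : r + 2 != 0 by rewrite gt_eqF.
exists a, b, c, d; rewrite /= -sumA -sumAc -sumS -sumQ.
split; last by split; rewrite mulrC divfK.
by split; apply: divr_gt0 => //; lra.
Qed.

(* Test vector: [a] on [S'], [b] on [A :\: S'], [d] on [Q'], [c] on [~: A :\: Q']. *)
Lemma gap_test_vector (R : realType) (T : finType) (e : rel T) (A S Q S' Q' : {set T})
    (r a b c d : R) :
  (2 < #|T|)%N -> symmetric e -> (forall x y, e x y -> (x \in A) != (y \in A)) ->
  (forall x y, x \in S -> y \in Q -> ~~ e x y) ->
  S \subset A -> Q' \subset ~: A -> S' \subset S -> Q \subset Q' ->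
  largest_eigenvalue (distmx R e) r ->
  0 < a -> 0 < b -> 0 < c -> 0 < d ->
  let p := a * #|S'|%:R + b * #|A :\: S'|%:R in
  let q := d * #|Q'|%:R + c * #|~: A :\: Q'|%:R in
  let form := 2 * p ^+ 2 + 2 * q ^+ 2 + 2 * p * q +
    4 * (a * #|S'|%:R + b * #|S :\: S'|%:R) * (d * #|Q|%:R) in
  let bound := (r + 2) * (a ^+ 2 * #|S'|%:R + b ^+ 2 * #|A :\: S'|%:R +
                          d ^+ 2 * #|Q'|%:R + c ^+ 2 * #|~: A :\: Q'|%:R) in
  form <= bound /\
  ((exists x y, (gap_dist A S Q x y < gdist e x y)%N) -> form < bound).
Proof.
move=> T3 sym_e bip noSQ SA Q'A S'S QQ' maxr a0 b0 c0 d0 p q form bound.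
have S'A := subset_trans S'S SA; have QA := subset_trans QQ' Q'A.
pose h x := if x \in A then if x \in S' then a else b
            else if x \in Q' then d else c.
have h_gt0 x : 0 < h x by rewrite /h; do 2 case: ifP.
have sumS' (f : T -> R) x0 (B : {set T}) : (forall x, x \in B -> f x = x0) ->
    \sum_(x in B) f x = x0 * #|B|%:R.
  by move=> fB; rewrite mulr_natr -sumr_const; apply: eq_bigr.
have hS' x : x \in S' -> h x = a.
  by move=> xS; rewrite /h (subsetP S'A) // xS.
have hA x : x \in A :\: S' -> h x = b.
  by rewrite /h inE => /andP[/negPf-> ->].
have hQ' x : x \in Q' -> h x = d.
  by move=> xQ; have := subsetP Q'A _ xQ; rewrite /h inE xQ => /negPf->.
have hAc x : x \in ~: A :\: Q' -> h x = c.
  by rewrite /h !inE => /andP[/negPf-> /negPf->].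
have hS x : x \in S :\: S' -> h x = b.
  by rewrite inE => /andP[xS' /(subsetP SA) xA]; apply: hA; rewrite inE xS' xA.
have hQ x : x \in Q -> h x = d by move/(subsetP QQ'); apply: hQ'.
have sum_sub (f : T -> R) x0 x1 (B C : {set T}) : B \subset C ->
    (forall x, x \in B -> f x = x0) -> (forall x, x \in C :\: B -> f x = x1) ->
    \sum_(x in C) f x = x0 * #|B|%:R + x1 * #|C :\: B|%:R.
  by move=> BC fB fC; rewrite (big_setID B) /= (setIidPr BC); congr (_ + _); apply: sumS'.
(* The gap is still [S], [Q], whereas [h] follows [S'], [Q']: on [S] it takes both values [a] and
   [b], on [Q] only [d]. *)
have form_ge : \sum_x h x * (\sum_y (gap_dist A S Q x y)%:R * h y) +
    2 * \sum_x h x ^+ 2 = form.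
  rewrite gap_dist_form // /form /p /q (sumS' _ _ _ hQ) (sum_sub _ _ _ _ _ S'A hS' hA).
  by rewrite (sum_sub _ _ _ _ _ Q'A hQ' hAc) (sum_sub _ _ _ _ _ S'S hS' hS).
have normE : \sum_x h x ^+ 2 = a ^+ 2 * #|S'|%:R + b ^+ 2 * #|A :\: S'|%:R +
                          d ^+ 2 * #|Q'|%:R + c ^+ 2 * #|~: A :\: Q'|%:R.
  rewrite -[RHS]addrA -(sum_sub (fun x => h x ^+ 2) _ _ _ _ S'A) => [|x /hS'->|x /hA->] //.
  rewrite -(sum_sub (fun x => h x ^+ 2) _ _ _ _ Q'A) => [|x /hQ'->|x /hAc->] //.
  rewrite (bigID (mem A)) /=; congr (_ + _); apply: eq_bigl => x; by rewrite !inE.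
have ray : \sum_x h x * (\sum_y (gdist e x y)%:R * h y) + 2 * \sum_x h x ^+ 2 <= bound.
  rewrite /bound -normE (mulrDl r) lerD2r; apply: kernel_form_le maxr _.
  by move=> u v; rewrite gdist_sym.
have le_term x y : h x * ((gap_dist A S Q x y)%:R * h y) <= h x * ((gdist e x y)%:R * h y).
  rewrite ler_pM2l // ler_pM2r // ler_nat; exact: gap_dist_le_gdist.
rewrite -form_ge; split=> [|[x [y lt_xy]]].
  apply: le_trans ray; rewrite lerD2r; apply: ler_sum => x _.
  by rewrite !mulr_sumr; apply: ler_sum.
(* All entries of [h] are positive, so one strictly larger distance makes the whole sum strictly
   larger. *)
apply: lt_le_trans ray; rewrite ltrD2r (bigD1 x) //= [ltRHS](bigD1 x) //=.
apply: ltr_leD; last first.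
  by apply: ler_sum => z _; rewrite !mulr_sumr; apply: ler_sum.
rewrite !mulr_sumr (bigD1 y) //= [ltRHS](bigD1 y) //=; apply: ltr_leD.
  by rewrite ltr_pM2l // ltr_pM2r // ltr_nat.
exact: ler_sum.
Qed.

(** * The extremal graph *)

(* Eigenvalue equations of [D + 2I] on a gap graph whose four classes have sizes
   [2], [k - 2], [1] and [k - 1]. *)
Definition gap_eigen (R : realFieldType) (k mu a b c d : R) : Prop :=
  let p := a * 2 + b * (k - 2) in
  let q := d * (k - 1) + c in
  [/\ 0 < a, 0 < b, 0 < c & 0 < d] /\
  [/\ mu * a = 2 * p + q + 2 * (d * (k - 1)), mu * b = 2 * p + q,
      mu * c = 2 * q + p & mu * d = 2 * q + p + 2 * (a * 2)].

(** Weight each eigenvalue equation by its entry times its class size and add. *)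
Lemma gap_eigen_form (R : realFieldType) (k mu a b c d : R) :
  gap_eigen k mu a b c d ->
  let p := a * 2 + b * (k - 2) in
  let q := d * (k - 1) + c in
  2 * p ^+ 2 + 2 * q ^+ 2 + 2 * p * q + 4 * (a * 2) * (d * (k - 1)) =
  mu * (a ^+ 2 * 2 + b ^+ 2 * (k - 2) + d ^+ 2 * (k - 1) + c ^+ 2).
Proof.
move=> [_ [Ea Eb Ec Ed]] /=.
transitivity (2 * a * (mu * a) + (k - 2) * b * (mu * b) + (k - 1) * d * (mu * d) +
              c * (mu * c)); last by ring.
by rewrite Ea Eb Ec Ed; ring.
Qed.

(* Summing the eigenvalue equations over all vertices gives [3 k + 3 <= mu];
   if [2 b <= a], the equations for [a] and [d] would give
   [2 mu ^ 2 <= (5 k - 2) mu + 32 (k - 1)], which is smaller. *)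
Lemma gap_eigen_ratio (R : realFieldType) (k mu a b c d : R) :
  gap_eigen k mu a b c d -> 4 <= k -> a < 2 * b.
Proof.
rewrite /gap_eigen; set p := _ + b * _; set q := _ + c.
move=> [[a0 b0 c0 d0] [Ea Eb Ec Ed]] k4; rewrite ltNge; apply/negP => ab.
have p_gt0 : 0 < p by rewrite /p addr_gt0 ?mulr_gt0 //; lra.
have q_gt0 : 0 < q by rewrite /q addr_gt0 ?mulr_gt0 //; lra.
have dk0 : 0 < d * (k - 1) by rewrite mulr_gt0 //; lra.
have mu0 : 0 < mu by rewrite -(pmulr_lgt0 _ b0) Eb; lra.
have cd : c <= d by rewrite -(ler_pM2l mu0) Ec Ed; lra.
have mu_ge : 3 * k + 3 <= mu.
  rewrite -(ler_pM2r (addr_gt0 p_gt0 q_gt0)).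
  (* Since [b <= a] and [c <= d], [p + q <= k (a + d)], and [3 k <= 4 (k - 1)] for [k >= 4]. *)
  have -> : mu * (p + q) = 3 * k * (p + q) + 4 * (k - 1) * (a + d).
    transitivity (2 * (mu * a) + (k - 2) * (mu * b) + (k - 1) * (mu * d) + mu * c).
      by rewrite /p /q; ring.
    by rewrite Ea Eb Ec Ed /p /q; ring.
  have ba : b <= a by lra.
  have ? : 0 <= (k - 4) * (a - b) by rewrite mulr_ge0 //; lra.
  have ? : 0 <= (k - 4) * a by rewrite mulr_ge0 //; lra.
  have ? : 0 <= (k - 4) * d by rewrite mulr_ge0 //; lra.
  rewrite /p /q; lra.
have dk_ge : 4 * a + 2 * (k - 2) * b + c <= d * (k - 1).
  have : mu * (2 * b) <= mu * a by rewrite ler_pM2l.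
  by rewrite mulrCA Ea Eb /p /q; lra.
have a_le : mu * a <= 4 * (k - 1) * d by rewrite Ea /p /q; lra.
have d_le : 2 * (mu * d) <= (5 * k - 2) * d + 8 * a by rewrite Ed /p /q; lra.
have : mu * (2 * (mu * d)) <= ((5 * k - 2) * mu + 32 * (k - 1)) * d.
  have : mu * (2 * (mu * d)) <= mu * ((5 * k - 2) * d + 8 * a) by rewrite ler_pM2l.
  by lra.
have -> : mu * (2 * (mu * d)) = 2 * mu ^+ 2 * d by ring.
rewrite ler_pM2r // leNgt => /negP; apply.
(* The product is [2 mu ^ 2 - (5 k - 2) mu - (3 k ^ 2 + 27 k + 24)], and
   [3 k ^ 2 + 27 k + 24 > 32 (k - 1)]. *)
have ? : 0 <= (mu - (3 * k + 3)) * (2 * mu + k + 8) by rewrite mulr_ge0 //; lra.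
nra.
Qed.

(** A Collatz-Wielandt bound: the positive weights in [y], roughly class size times Perron entry,
    are multiplied by at most 19 in each coordinate under the transposed system. *)
Lemma gap_eigen_le19 (R : realFieldType) (mu a b c d : R) :
  gap_eigen 5 mu a b c d -> mu <= 19.
Proof.
move=> [[a0 b0 c0 d0] [Ea Eb Ec Ed]]; pose y := 63 * a + 60 * b + 20 * c + 106 * d.
have y_gt0 : 0 < y by rewrite /y; lra.
rewrite -(ler_pM2r y_gt0).
have -> : mu * y = 63 * (mu * a) + 60 * (mu * b) + 20 * (mu * c) + 106 * (mu * d).
  by rewrite /y; ring.
by rewrite Ea Eb Ec Ed /y; lra.
Qed.

(** * Distances in $B_{n-1,n-2}$ *)

Section BGraph.
Local Open Scope nat_scope.
Variable n : nat.
Hypothesis n3 : 3 <= n.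

(** These three sets serve as [A], [S] and [Q]. [B_far] omits vertex 0, the only neighbour of the
    pendent vertices. *)
Definition B_part : {set 'I_n.*2} := [set i : 'I_n.*2 | n <= i].
Definition B_pendent : {set 'I_n.*2} := [set i : 'I_n.*2 | n.*2 - 2 <= i].
Definition B_far : {set 'I_n.*2} := [set i : 'I_n.*2 | 0 < i < n].

Lemma card_ord_interval m lo hi :
  hi <= m -> #|[set i : 'I_m | lo <= i < hi]| = hi - lo.
Proof.
move=> le_hi; rewrite -sum1_card -[RHS]muln1 -sum_nat_const_nat.
rewrite (big_nat_widen _ _ _ _ _ le_hi) (big_nat_widenl _ 0) // big_mkord.
by apply: eq_bigl => i; rewrite inE /= andbC.
Qed.

Lemma card_B_part : #|B_part| = n.
Proof.
rewrite -[RHS](addnK n) addnn -(card_ord_interval n (leqnn _)).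
by apply: eq_card => i; rewrite !inE ltn_ord andbT.
Qed.

Lemma card_B_pendent : #|B_pendent| = 2.
Proof.
transitivity (n.*2 - (n.*2 - 2)); last by lia.
rewrite -(card_ord_interval _ (leqnn _)); apply: eq_card => i.
by rewrite !inE ltn_ord andbT.
Qed.

Lemma card_B_far : #|B_far| = n.-1.
Proof. by rewrite -subn1 -(@card_ord_interval n.*2) // -addnn leq_addr. Qed.

Lemma B_pendent_sub : B_pendent \subset B_part.
Proof. by apply/subsetP => i; rewrite !inE; lia. Qed.

Lemma B_far_sub : B_far \subset ~: B_part.
Proof. by apply/subsetP => i; rewrite !inE; lia. Qed.

Lemma Bgraph_sym : symmetric (@Bgraph n).
Proof. by move=> i j; rewrite /Bgraph orbC. Qed.

Lemma Bgraph_bipartite (i j : 'I_n.*2) :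
  Bgraph i j -> (i \in B_part) != (j \in B_part).
Proof. by rewrite /Bgraph /B_edge !inE; lia. Qed.

Lemma BgraphE (i j : 'I_n.*2) : i \in B_part -> j \notin B_part ->
  Bgraph i j = ~~ ((i \in B_pendent) && (j \in B_far)).
Proof. by move: (ltn_ord i) (ltn_ord j); rewrite /Bgraph /B_edge !inE; lia. Qed.

Lemma Bgraph_gdist (i j : 'I_n.*2) :
  gdist (@Bgraph n) i j = gap_dist B_part B_pendent B_far i j.
Proof.
have nn : 3 < n.*2 by lia.
have walkS k (x y z : 'I_n.*2) : Bgraph x y -> walk (@Bgraph n) k y z -> walk (@Bgraph n) k.+1 x z.
  by move=> xy yz; apply/existsP; exists y; rewrite xy.
apply/eqP; rewrite eqn_leq; apply/andP; split; last first.
  apply: gap_dist_le_gdist; rewrite ?card_ord; [exact: ltnW| exact: Bgraph_sym | exact: Bgraph_bipartite |].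
  move=> x y xS yQ; rewrite BgraphE ?xS ?yQ //; first exact: subsetP B_pendent_sub _ xS.
  by have := subsetP B_far_sub _ yQ; rewrite inE.
have lt0 : 0 < n.*2 by lia.
have ltn_n : n < n.*2 by lia.
(* Vertex 0 is adjacent to all of [B_part], and vertex [n], not pendent since [n >= 3], to all of
   the other side. Walks through one or both of them attain the lengths 2 and 3. *)
pose o : 'I_n.*2 := Ordinal lt0; pose m : 'I_n.*2 := Ordinal ltn_n.
have oj x : x \in B_part -> Bgraph x o.
  by move=> xB; rewrite BgraphE // !inE /=; lia.
have mj x : x \notin B_part -> Bgraph m x.
  by move=> xB; rewrite BgraphE // !inE /=; lia.
have o_notin : o \notin B_part by rewrite inE /=; lia.
have m_in : m \in B_part by rewrite inE /=.
rewrite /gap_dist; have [<-|ij] := eqVneq i j.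
  by apply: gdist_le; rewrite ?card_ord //=.
have [sameB|diffB] := eqVneq (i \in B_part) (j \in B_part).
  apply: gdist_le; first by rewrite card_ord ltnW.
  have [iB|iB] := boolP (i \in B_part); rewrite ?(negPf iB) ?iB in sameB.
    apply: (walkS _ _ o); first exact: oj.
    by rewrite walk1 Bgraph_sym oj // -sameB.
  apply: (walkS _ _ m); first by rewrite Bgraph_sym mj.
  by rewrite walk1 mj // -sameB.
wlog iB : i j ij diffB / i \in B_part.
  move=> H; have [|iB] := boolP (i \in B_part); first exact: H.
  rewrite gdist_sym; last exact: Bgraph_sym.
  rewrite orbC; apply: H; rewrite 1?eq_sym //.
  by move: diffB; rewrite (negPf iB); case: (j \in _).
have jB : j \notin B_part by move: diffB; rewrite iB; case: (j \in _).
case: ifP => gap.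
  apply: gdist_le; rewrite ?card_ord //.
  apply: (walkS _ _ o); first exact: oj.
  by apply: (walkS _ _ m); rewrite ?walk1 ?mj // Bgraph_sym oj.
apply: gdist_le; first by rewrite card_ord; lia.
rewrite walk1 BgraphE //; apply/negP => gap'.
by rewrite gap' in gap.
Qed.

End BGraph.

(* Listing [~: A :\: Q], [Q], [A :\: S] and [S] in this order numbers the
   vertices as in [Bgraph]. *)
Lemma isomorphic_Bgraph (T : finType) (e : rel T) (n : nat) (A S Q : {set T}) :
  (3 <= n)%N -> symmetric e -> (forall x y, e x y -> (x \in A) != (y \in A)) ->
  #|A| = n -> #|~: A| = n -> S \subset A -> Q \subset ~: A ->
  #|S| = 2%N -> #|Q| = n.-1 ->
  (forall x y, x \in A -> y \notin A -> e x y = ~~ ((x \in S) && (y \in Q))) ->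
  isomorphic e (@Bgraph n).
Proof.
move=> n3 sym_e bip cA cAc SA QA cS cQ eE.
pose l1 := enum (~: A :\: Q); pose l2 := enum Q.
pose l3 := enum (A :\: S); pose l4 := enum S.
pose l := (l1 ++ l2) ++ (l3 ++ l4).
have sz1 : size l1 = 1%N.
  by rewrite -cardE cardsD (setIidPr QA) cAc cQ; lia.
have sz2 : size l2 = n.-1 by rewrite -cardE.
have sz3 : size l3 = (n - 2)%N by rewrite -cardE cardsD (setIidPr SA) cA cS.
have sz4 : size l4 = 2%N by rewrite -cardE.
have szl : size l = n.*2 by rewrite !size_cat sz1 sz2 sz3 sz4; lia.
have m12 x : (x \in l1 ++ l2) = (x \notin A).
  rewrite mem_cat !mem_enum !inE; have [xQ|_] := boolP (x \in Q); last by rewrite orbF.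
  by have := subsetP QA _ xQ; rewrite inE => ->.
have m34 x : (x \in l3 ++ l4) = (x \in A).
  rewrite mem_cat !mem_enum !inE; have [xS|] := boolP (x \in S); last by rewrite orbF.
  by rewrite (subsetP SA).
have ml x : x \in l by rewrite mem_cat m12 m34 orNb.
have lt_idx x : (index x l < n.*2)%N by rewrite -szl index_mem.
pose f x : 'I_n.*2 := Ordinal (lt_idx x).
have idxA x : x \in A -> index x l = (n + index x (l3 ++ l4))%N.
  by move=> xA; rewrite index_cat m12 xA /= size_cat sz1 sz2; lia.
have idxAc x : x \notin A -> index x l = index x (l1 ++ l2).
  by move=> xA; rewrite index_cat m12 xA.
have inB x : (f x \in B_part n) = (x \in A).
  rewrite inE /=; have [xA|xA] := boolP (x \in A); first by rewrite idxA // leq_addr.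
  have : x \in l1 ++ l2 by rewrite m12.
  by rewrite idxAc // -index_mem size_cat sz1 sz2; lia.
have inS x : x \in A -> (f x \in B_pendent n) = (x \in S).
  move=> xA; rewrite inE /= idxA // index_cat sz3 mem_enum !inE xA andbT.
  case: ifPn => [xS|/negbNE->]; last by lia.
  have : x \in l3 by rewrite mem_enum !inE xS.
  by rewrite -index_mem sz3 (negPf xS); lia.
have inQ x : x \notin A -> (f x \in B_far n) = (x \in Q).
  move=> xA; have := inB x; rewrite !inE (negPf xA) => /negbT; rewrite -ltnNge => -> /=.
  rewrite andbT idxAc // index_cat sz1 mem_enum !inE xA andbT.
  case: ifPn => [xQ|/negbNE-> //]; have : x \in l1 by rewrite mem_enum !inE xQ.
  by rewrite -index_mem sz1 (negPf xQ); lia.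
have inj_f : injective f.
  by move=> x y /(congr1 val) /= /(congr1 (nth x l)); rewrite !nth_index.
exists f; split.
  by apply: inj_card_bij inj_f _; rewrite card_ord -(cardsC A) cA cAc addnn.
move=> x y; have [xA|xA] := boolP (x \in A); have [yA|yA] := boolP (y \in A).
- have -> : e x y = false by apply/negP => /bip; rewrite xA yA.
  by apply/negP => /(Bgraph_bipartite n3); rewrite !inB xA yA.
- by rewrite BgraphE ?inB // inS // inQ // eE.
- by rewrite Bgraph_sym sym_e BgraphE ?inB // inS // inQ // eE.
- have -> : e x y = false by apply/negP => /bip; rewrite (negPf xA) (negPf yA).
  by apply/negP => /(Bgraph_bipartite n3); rewrite !inB (negPf xA) (negPf yA).
Qed.

Lemma Bgraph_eigen (R : realType) (n : nat) (r : R) :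
  (3 <= n)%N -> largest_eigenvalue (distmx R (@Bgraph n)) r ->
  exists a b c d : R, gap_eigen n%:R (r + 2) a b c d.
Proof.
move=> n3 maxr.
have distB : distmx R (@Bgraph n) = kernelmx (fun u v =>
    (gap_dist (B_part n) (B_pendent n) (B_far n) u v)%:R).
  by apply/matrixP => i j; rewrite kernelmxE mxE Bgraph_gdist.
rewrite distB in maxr.
have SA := B_pendent_sub n3; have QA := B_far_sub n3.
have B_neq0 : B_part n != set0 by rewrite -card_gt0 card_B_part (leq_trans _ n3).
have [a [b [c [d]]]] := gap_perron SA QA B_neq0 maxr.
have cB : #|~: B_part n| = n.
  by apply/(@addnI n); rewrite -{1}(card_B_part n) cardsC card_ord addnn.
rewrite !cardsD (setIidPr SA) (setIidPr QA) card_B_part cB card_B_pendent // card_B_far.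
have -> : (n - n.-1 = 1)%N by lia.
rewrite -subn1 !natrB ?(leq_trans _ n3) // mulr1 => E.
by exists a, b, c, d.
Qed.

(** * Comparison of the two distance spectral radii *)

Theorem theorem1p2 (R : realType) (n : nat) (T : finType) (e : rel T) :
  (3 <= n)%N ->
  simple_graph e -> connected_graph e -> balanced_bipartite e n ->
  forall r1 r2 : R,
    largest_eigenvalue (distmx R e) r1 ->
    largest_eigenvalue (distmx R (@Bgraph n)) r2 ->
    r1 <= r2 ->
    has_perfect_matching e \/ isomorphic e (@Bgraph n).
Proof.
move=> n3 simple_e conn balanced r1 r2 max1 max2 le12.
have nB1 : (n - n.-1 = 1)%N by lia.
have [|[A [S [Q]]]] := perfect_matching_or_gap n3 simple_e conn balanced; first by left.
move=> [[cA cAc bip] [[SA QA noSQ] [cSQ S2 SQ]]]; right.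
have [sym_e _] := simple_e.
have T3 : (2 < #|T|)%N by rewrite -(cardsC A) cA cAc; lia.
have [a [b [c [d eig]]]] := Bgraph_eigen n3 max2.
have [[a0 b0 c0 d0] _] := eig.
have test S' Q' a' b' c' d' :=
  @gap_test_vector R T e A S Q S' Q' r1 a' b' c' d' T3 sym_e bip noSQ SA.
have n3R : 3 <= n%:R :> R by rewrite (ler_nat R 3).
set k : R := n%:R in eig n3R.
set norm := a ^+ 2 * 2 + b ^+ 2 * (k - 2) + d ^+ 2 * (k - 1) + c ^+ 2.
have norm_gt0 : 0 < norm.
  by rewrite /norm !addr_gt0 ?mulr_gt0 ?exprn_gt0 //; lra.
have [S_eq2|S_neq2] := eqVneq #|S| 2%N.
  have cQ : #|Q| = n.-1 by clear -cSQ S_eq2; lia.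
  apply: (isomorphic_Bgraph n3 sym_e bip cA cAc SA QA S_eq2 cQ) => x y xA yA.
  apply/eqP; apply: contraT => exy.
  have gapxy : (x \in S) && (y \in Q) = false.
    by apply: contraNF exy => /[dup] /andP[xS yQ] ->; rewrite (negPf (noSQ _ _ xS yQ)).
  have nexy : ~~ e x y by move: exy; rewrite gapxy; case: (e x y).
  (* A further missing edge [x y] raises a distance from at most 2 to at least 3, which would give
     [r2 < r1]. *)
  have [_ strict] := test S Q a b c d QA (subxx _) (subxx _) max1 a0 b0 c0 d0.
  have: exists x y, (gap_dist A S Q x y < gdist e x y)%N.
    exists x, y; apply: leq_trans (nonadjacent_gdist_ge3 T3 sym_e bip _ nexy); last first.
      by rewrite xA (negPf yA).
    rewrite /gap_dist gapxy xA (negPf yA).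
    by case: eqP => // _; rewrite [y \in S](contraNF (subsetP SA y)).
  move/strict; rewrite !cardsD (setIidPr SA) (setIidPr QA) cA cAc S_eq2 cQ.
  rewrite nB1 setIid S_eq2 subnn -subn1 !natrB ?(leq_trans _ n3) // !mulr1 mulr0 addr0.
  by rewrite (gap_eigen_form eig) ltr_pM2r // ltrD2r ltNge le12.
have [Q_eq3|Q_neq3] := eqVneq #|Q| 3%N.
  have n5 : n = 5%N by clear -cSQ S2 SQ S_neq2 Q_eq3; lia.
  have S_eq3 : #|S| = 3%N by clear -cSQ n5 Q_eq3; lia.
  have k5 : k = 5 by rewrite /k n5.
  have le19 : r2 + 2 <= 19 by apply: (@gap_eigen_le19 _ _ a b c d); rewrite -k5.
  (* Here [p = q = 13], the form is 1338 and the squared norm 70, so [r1 + 2 >= 1338 / 70 > 19]. *)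
  have [] := test S Q 3 2 2 3 QA (subxx _) (subxx _) max1 _ _ _ _; rewrite ?ltr0n //.
  rewrite !cardsD (setIidPr SA) (setIidPr QA) cA cAc Q_eq3 S_eq3 n5.
  rewrite setIid S_eq3 (_ : (5 - 3 = 2)%N) // subnn => form_le _; exfalso.
  by clear -form_le le19 le12; lra.
(* [S'] and the complement of [C] in [~: A] give the classes the sizes they have in [Bgraph]. Norm,
   [p] and [q] then agree with those of its Perron vector, and only the gap term differs. *)
have [S' S'S cS'] : exists2 S' : {set T}, S' \subset S & #|S'| = 2%N.
  exact: subset_of_card.
have [C CAQ cC] : exists2 C : {set T}, C \subset ~: A :\: Q & #|C| = 1%N.
  by apply: subset_of_card; rewrite cardsD (setIidPr QA) cAc; clear -cSQ S2; lia.
have CA : C \subset ~: A := subset_trans CAQ (subsetDl _ _).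
have QQ' : Q \subset ~: A :\: C.
  apply/subsetP => y yQ; rewrite inE (subsetP QA) // andbT.
  by apply/negP => /(subsetP CAQ); rewrite inE yQ.
have [+ _] := test S' (~: A :\: C) a b c d (subsetDl _ _) S'S QQ' max1 a0 b0 c0 d0.
rewrite setDDr setDv set0U (setIidPr CA) cC !cardsD (setIidPr CA) (setIidPr S'S).
rewrite (setIidPr (subset_trans S'S SA)) cA cAc cC cS' !natrB ?(leq_trans _ n3) //.
rewrite !mulr1 -/k -/norm => le_form; exfalso.
have ratio : a < 2 * b by apply: gap_eigen_ratio eig _; rewrite (ler_nat R 4); clear -cSQ S2 SQ S_neq2 Q_neq3; lia.
have formE := gap_eigen_form eig; rewrite /= -/norm in formE.
have le_norm : (r1 + 2) * norm <= (r2 + 2) * norm by rewrite ler_pM2r // lerD2r.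
have : 4 * (a * 2 + b * (#|S|%:R - 2)) * (d * #|Q|%:R) <= 4 * (a * 2) * (d * (k - 1)).
  by clear -le_form formE le_norm; lra.
apply/negP; rewrite -ltNge.
have kE : k = #|S|%:R + #|Q|%:R - 1.
  by rewrite /k -natrD cSQ -natr1 addrK.
have s3 : 3 <= #|S|%:R :> R by rewrite (ler_nat R 3); clear -S2 S_neq2; lia.
have t4 : 4 <= #|Q|%:R :> R by rewrite (ler_nat R 4); clear -S2 SQ S_neq2 Q_neq3; lia.
rewrite -subr_gt0.
(* Substituting [k - 1 = #|S| + #|Q| - 2] makes the difference factor; it is positive because
   [2 a < 4 b <= #|Q| b]. *)
have -> : 4 * (a * 2 + b * (#|S|%:R - 2)) * (d * #|Q|%:R) - 4 * (a * 2) * (d * (k - 1)) =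
    4 * d * ((#|S|%:R - 2) * (b * #|Q|%:R - 2 * a)) by rewrite kE; ring.
rewrite !mulr_gt0 //; [lra|].
have : b * 4 <= b * #|Q|%:R by rewrite ler_pM2l.
lra.
Qed.
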